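(* Consider a channel with input alphabet $\mathcal X$ and output alphabet $\mathcal Y$ having Shannon capacity $C$, let $c>0$ be a constant independent of $m,n$, and let $C_{\mathrm{BFC}}$ denote the computation capacity for the class $\mathcal F_m^{\mathrm W}(S)$ with the indicated scaling function. Then: (1) for $S=c$ (a positive integer), $C_{\mathrm{BFC}}\le C$ with the scaling function $L(R,n)=2^{Rn}$; (2) for $S=cm^{\beta}$ with $\beta>0$, $C_{\mathrm{BFC}}\le \frac{C}{1+\beta}$ with the scaling function $L(R,n)=2^{Rn}$; (3) for $S=cm^{\log m}$, $C_{\mathrm{BFC}}\le\sqrt C$ with the scaling function $L(R,n)=2^{R\sqrt n}$; (4) for $S=c2^{m^{1/b}}$ with $b>1$, $C_{\mathrm{BFC}}\le C^{b}$ with the scaling function $L(R,n)=Rn^{b}$; (5) for $S=c2^{m/\log m}$, $C_{\mathrm{BFC}}\le C$ with the scaling function $L(R,n)=Rn\log n$; (6) for $S=c2^{\gamma m}$ with $\gamma\in(0,1]$, $C_{\mathrm{BFC}}\le \frac{C}{\gamma}$ with the scaling function $L(R,n)=Rn$.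
   Context: All logarithms are base 2. A channel with input alphabet $\mathcal X$ and output alphabet $\mathcal Y$ is given, for each blocklength $n$, by conditional distributions $W(\cdot\mid x^n)$ on $\mathcal Y^n$, $x^n\in\mathcal X^n$; $C$ denotes its (Shannon) capacity. Let $\mathcal F_m$ be the set of all Boolean functions $f:\{0,1\}^m\to\{0,1\}$; the Hamming weight of $f$ is $|f^{-1}[1]|$, and $\mathcal F_m^{\mathrm W}(S)=\{f\in\mathcal F_m:|f^{-1}[1]|=S\}$. For $\mathcal F\subseteq\mathcal F_m$, an $(n,m,\mathcal F,\lambda_1,\lambda_2)$ BFC code consists of probability distributions $Q_i$ on $\mathcal X^n$ for each $i\in\{0,1\}^m$ and sets $D_f\subseteq\mathcal Y^n$ for each $f\in\mathcal F$, such that for all $i,f$: if $f(i)=1$ then $Q_iW(D_f^c)\le\lambda_1$, and if $f(i)=0$ then $Q_iW(D_f)\le\lambda_2$, where $QW(D)=\sum_xQ(x)W(D\mid x)$. Given a scaling function $L:\mathbb R\times\mathbb N\to\mathbb R^+$ and a family of classes $\mathcal F(m)\subseteq\mathcal F_m$, $R$ is an achievable computation rate with scaling function $L$ if for all $\lambda_1,\lambda_2>0$, all $\gamma>0$ and all sufficiently large $n$ there is an $(n,m,\mathcal F(m),\lambda_1,\lambda_2)$ BFC code with $m>L(R-\gamma,n)$; the computation capacity $C_{\mathrm{BFC}}$ is the supremum of achievable computation rates.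
   Formalization: In (6), for γ=1 the formal theorem assumes c<1, since for c≥1 the class is empty or only the constant function 1 and C_BFC is infinite; the alphabets are taken finite, and non-integer weights S are rounded down. *)

(* Defs.v *)
From HB Require Import structures.
From mathcomp Require Import all_boot all_order all_algebra.
From mathcomp Require Import all_classical all_reals all_analysis.

Set Implicit Arguments.
Unset Strict Implicit.
Unset Printing Implicit Defensive.

Import Order.TTheory GRing.Theory Num.Theory.
Local Open Scope classical_set_scope.
Local Open Scope ring_scope.

Section BFC.
Variables (R : realType) (X Y : finType).

Definition log2 (x : R) : R := ln x / ln 2.

Definition is_distr (T : finType) (P : {ffun T -> R}) : Prop :=
  (forall t, 0 <= P t) /\ \sum_t P t = 1.

Definition channel := forall n : nat, n.-tuple X -> {ffun n.-tuple Y -> R}.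

Definition is_channel (W : channel) : Prop :=
  forall n (x : n.-tuple X), is_distr (W n x).

Definition Wprob (W : channel) n (x : n.-tuple X) (D : {set n.-tuple Y}) : R :=
  \sum_(y in D) W n x y.

Definition QW (W : channel) n (Q : {ffun n.-tuple X -> R}) (D : {set n.-tuple Y}) : R :=
  \sum_x Q x * Wprob W x D.

Definition is_tcode (W : channel) n M (u : 'I_M -> n.-tuple X)
    (D : 'I_M -> {set n.-tuple Y}) (lambda : R) : Prop :=
  (forall j k : 'I_M, j != k -> (D j :&: D k = finset.set0)) /\
  (forall j : 'I_M, Wprob W (u j) (~: D j) <= lambda).

Definition achievable_rate (W : channel) (r : R) : Prop :=
  forall lambda g : R, 0 < lambda -> 0 < g ->
  exists N : nat, forall n : nat, (N <= n)%N ->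
    exists M : nat, (2 `^ (n%:R * (r - g)) <= M%:R) /\
      exists (u : 'I_M -> n.-tuple X) (D : 'I_M -> {set n.-tuple Y}),
        is_tcode W u D lambda.

Definition shannon_capacity (W : channel) : \bar R :=
  ereal_sup (EFin @` [set r | achievable_rate W r]).

Definition bfun (m : nat) := {ffun m.-tuple bool -> bool}.

Definition hweight m (f : bfun m) : nat := #|[set i | f i]|.

Definition weight_class m (S : nat) : pred (bfun m) :=
  [pred f : bfun m | hweight f == S].

Definition is_bfc_code (W : channel) n m (F : pred (bfun m))
    (Q : m.-tuple bool -> {ffun n.-tuple X -> R})
    (D : bfun m -> {set n.-tuple Y}) (l1 l2 : R) : Prop :=
  (forall i, is_distr (Q i)) /\
  (forall (i : m.-tuple bool) (f : bfun m), f \in F ->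
     (f i -> QW W (Q i) (~: D f) <= l1) /\
     (~~ f i -> QW W (Q i) (D f) <= l2)).

Definition achievable_comp_rate (W : channel) (L : R -> nat -> R)
    (Fam : forall m : nat, pred (bfun m)) (r : R) : Prop :=
  forall l1 l2 g : R, 0 < l1 -> 0 < l2 -> 0 < g ->
  exists N : nat, forall n : nat, (N <= n)%N ->
    exists m : nat, L (r - g) n < m%:R /\
      exists (Q : m.-tuple bool -> {ffun n.-tuple X -> R})
             (D : bfun m -> {set n.-tuple Y}),
        is_bfc_code W (Fam m) Q D l1 l2.

Definition bfc_capacity (W : channel) (L : R -> nat -> R)
    (Fam : forall m : nat, pred (bfun m)) : \bar R :=
  ereal_sup (EFin @` [set r | achievable_comp_rate W L Fam r]).

Definition wclass (s : nat -> R) : forall m : nat, pred (bfun m) :=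
  fun m => @weight_class m (Num.truncn (s m)).

End BFC.

(* Main.v *)
Require Import Defs.
From HB Require Import structures.
From mathcomp Require Import all_boot all_order all_algebra.
From mathcomp Require Import all_classical all_reals all_analysis.
From mathcomp Require Import zify ring lra.

(** A weight-S code separates so many functions that it contains a large
    identification code, and identification codes are no larger than what
    transmission codes of the same channel allow.

    From functions to identification.  Choose T blocks of 2^p messages and S - T
    further messages.  A word g, which picks one message in each block, gives the
    function of weight S that is 1 on the picked messages and on the further
    ones.  By sphere packing there are about 2^(pT/2h) words (p >= 2h) that
    pairwise agree in at most T/h positions; encoding g by the uniform mixture of
    its picked messages turns them into an identification code with second error
    at most l2 + 1/h.

    From identification to transmission (partial resolvability).  If there is no
    transmission code of size M and error lam then, by Feinstein's maximal code
    argument, every input distribution P puts mass at least lam/2 on pairs (x, y)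
    with W(y|x) <= (2M/lam) PW(y).  On these pairs the output is approximated, up
    to a fraction of lam, by the output of a uniform K-tuple of inputs with K
    proportional to M.  If J + 1 > 4/lam identification messages shared the same
    K-tuple, their decoding sets with overlaps removed would each have mass at
    least lam/4 under the output of that tuple, hence total mass above 1.  So an
    identification code has at most J |X|^(nK) messages.

    Together, p T = O(n M): the largest M is at least p T up to a factor linear
    in n, which is negligible on the exponential scale.  It remains to choose T
    and p from S and m: T = 1 for constant S, T = S with p = m/2 for
    polynomial S, and T proportional to S with constant p for larger S. *)

Import Order.TTheory GRing.Theory Num.Theory.
Local Open Scope ring_scope.

Set Implicit Arguments.
Unset Strict Implicit.
Unset Printing Implicit Defensive.

(** * Finite channels *)

Section FiniteChannel.
Context {R : realType}.

Definition prob (T : finType) (P : {ffun T -> R}) (D : {set T}) : R :=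
  \sum_(t in D) P t.

Lemma distr_inhabited (T : finType) (P : {ffun T -> R}) :
  is_distr P -> exists t : T, true.
Proof.
case=> _ P1; case: (pickP (fun _ : T => true)) => [t _|T0]; first by exists t.
by move: P1; rewrite big_pred0 // => /eqP; rewrite eq_sym oner_eq0.
Qed.

Lemma exists_le_mean (T : finType) (P : {ffun T -> R}) (F : T -> R) :
  is_distr P -> exists t, F t <= \sum_t P t * F t.
Proof.
move=> dP; have [t0 _] := distr_inhabited dP.
have [t _ tmin] := @arg_minP _ _ _ t0 predT F isT.
exists t; case: dP => P0 P1; rewrite -[leLHS]mul1r -P1 mulr_suml.
by apply: ler_sum => u _; rewrite ler_wpM2l // tmin.
Qed.

Lemma probC (T : finType) (P : {ffun T -> R}) (D : {set T}) :
  is_distr P -> prob P D + prob P (~: D) = 1.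
Proof.
case=> _ <-; rewrite /prob [RHS](bigID (mem D)) /=; congr (_ + _).
by apply: eq_bigl => t; rewrite inE.
Qed.

Lemma prob_ge0 (T : finType) (P : {ffun T -> R}) (D : {set T}) :
  is_distr P -> 0 <= prob P D.
Proof. by case=> P0 _; apply: sumr_ge0. Qed.

Lemma prob_le1 (T : finType) (P : {ffun T -> R}) (D : {set T}) :
  is_distr P -> prob P D <= 1.
Proof. by move=> dP; rewrite -(probC D dP) lerDl prob_ge0. Qed.

Lemma probE (T : finType) (P : {ffun T -> R}) (D : {set T}) :
  prob P D = \sum_t P t * (t \in D)%:R.
Proof.
rewrite /prob big_mkcond; apply: eq_bigr => t _.
by case: (t \in D); rewrite ?mulr1 ?mulr0.
Qed.

Section Channel.
Context {A B : finType}.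
Variable W : A -> {ffun B -> R}.
Hypothesis dW : forall x, is_distr (W x).

Definition output (P : {ffun A -> R}) : {ffun B -> R} :=
  [ffun y => \sum_x P x * W x y].

Lemma output_distr P : is_distr P -> is_distr (output P).
Proof.
case=> P0 P1; split=> [y|].
  rewrite ffunE; apply: sumr_ge0 => x _; apply: mulr_ge0 => //.
  by case: (dW x).
under eq_bigr do rewrite ffunE.
rewrite exchange_big /= -P1; apply: eq_bigr => x _.
by rewrite -mulr_sumr; case: (dW x) => _ ->; rewrite mulr1.
Qed.

Lemma prob_output P D : prob (output P) D = \sum_x P x * prob (W x) D.
Proof.
rewrite /prob; under eq_bigr do rewrite ffunE.
by rewrite exchange_big /=; apply: eq_bigr => x _; rewrite mulr_sumr.
Qed.

Definition code_exists (M : nat) (lam : R) : Prop :=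
  exists (u : 'I_M -> A) (D : 'I_M -> {set B}),
    (forall j k, j != k -> D j :&: D k = finset.set0) /\
    (forall j, prob (W (u j)) (~: D j) <= lam).

(* The outputs of low information density with [x]. *)
Definition lowinfo (P : {ffun A -> R}) (L : R) (x : A) : {set B} :=
  [set y | W x y <= L * output P y]%SET.

Lemma feinstein P (L lam : R) (M : nat) : is_distr P -> 0 < L ->
  \sum_x P x * prob (W x) (lowinfo P L x) + M%:R / L < lam ->
  code_exists M lam.
Proof.
move=> dP L0 small; have dO := output_distr dP.
have [x0 _] := distr_inhabited dP.
suff: forall k, (k <= M)%N -> exists (u : nat -> A) (D : nat -> {set B}),
    [/\ forall i j, (i < j < k)%N -> D i :&: D j = finset.set0,
        forall j, (j < k)%N -> prob (W (u j)) (~: D j) <= lam &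
        forall j, (j < k)%N -> prob (output P) (D j) <= L^-1].
  move=> /(_ M (leqnn M))[u [D [disj err _]]].
  exists (fun j => u j), (fun j => D j); split=> [j k|j]; last exact: err.
  rewrite neq_ltn => /orP[jk|kj]; first by rewrite disj// jk /=.
  by rewrite finset.setIC disj// kj /=.
elim=> [_|k IH kM].
  by exists (fun=> x0), (fun=> finset.set0); split=> // i j; rewrite ltn0 andbF.
have [u [D [disj err mass]]] := IH (ltnW kM).
pose U := (\bigcup_(j < k) D j)%SET.
have UM : prob (output P) U <= M%:R / L.
  apply: (@le_trans _ _ (\sum_(j < k) prob (output P) (D j))).
    rewrite probE [leRHS](eq_bigr _ (fun j _ => probE _ _)).
    rewrite exchange_big /=; apply: ler_sum => y _.
    have y0 : 0 <= output P y by case: dO.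
    rewrite -mulr_sumr ler_wpM2l //.
    case: (boolP (y \in U)) => [/bigcupP[j _ yj]|_]; last by rewrite sumr_ge0.
    by rewrite (bigD1 j) //= yj lerDl sumr_ge0.
  apply: (@le_trans _ _ (\sum_(j < k) L^-1)); first by apply: ler_sum => j _; apply: mass.
  rewrite sumr_const card_ord -[leLHS]mulr_natl ler_wpM2r ?invr_ge0 ?(ltW L0)//.
  by rewrite ler_nat ltnW.
pose G x := ~: lowinfo P L x :\: U.
have [x] := @exists_le_mean _ P (fun x => prob (W x) (~: G x)) dP.
move=> xG.
have Gsmall : prob (W x) (~: G x) <= lam.
  apply: (le_trans xG); apply: ltW; apply: le_lt_trans small.
  apply: le_trans (lerD (lexx _) UM).
  rewrite prob_output -big_split /=; apply: ler_sum => z _.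
  have z0 : 0 <= P z by case: dP.
  rewrite -mulrDr ler_wpM2l // !probE -big_split /=; apply: ler_sum => y _.
  have w0 : 0 <= W z y by case: (dW z).
  rewrite -mulrDr ler_wpM2l // -natrD ler_nat !inE.
  by case: (y \in U); case: (_ <= _).
exists (fun j => if j == k then x else u j), (fun j => if j == k then G x else D j).
split=> [i j|j|j].
- rewrite ltnS => /andP[ij]; rewrite leq_eqVlt => /orP[/eqP jk|jk].
    rewrite jk eqxx; rewrite jk in ij; rewrite (ltn_eqF ij).
    apply/setP => y; rewrite !inE; apply/negP => /andP[yi /andP[/negP yU _]].
    by apply: yU; apply/bigcupP; exists (Ordinal ij).
  by rewrite (ltn_eqF jk) (ltn_eqF (ltn_trans ij jk)) disj ?ij.
- by rewrite ltnS leq_eqVlt => /predU1P[->|jk]; rewrite ?eqxx // (ltn_eqF jk) err.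
rewrite ltnS leq_eqVlt => /predU1P[->|jk]; last by rewrite (ltn_eqF jk) mass.
rewrite eqxx -(ler_pM2l L0) divff ?gt_eqF//.
apply: le_trans (prob_le1 (G x) (dW x)).
rewrite /prob mulr_sumr; apply: ler_sum => y; rewrite !inE => /andP[_].
by rewrite -ltNge => /ltW.
Qed.

End Channel.

Section Quantization.
Context {A B : finType}.
Variables (P : {ffun A -> R}) (w : {ffun B -> R}) (V : A -> B -> R) (L : R).
Hypotheses (dP : is_distr P) (dw : is_distr w).
Hypotheses (V0 : forall x y, 0 <= V x y) (V1 : forall x, \sum_y V x y <= 1).
Hypotheses (L0 : 0 <= L) (VL : forall x y, V x y <= L * w y).

Let mu y := \sum_x P x * V x y.
Let h (s : seq A) y := \sum_(x <- s) V x y - (size s)%:R * mu y.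

(* Greedy choice: appending the best [x] raises the weighted square error by at
   most its [P]-mean, whose cross term vanishes. *)
Lemma quantize_L2 K : exists s : K.-tuple A,
  \sum_y h s y ^+ 2 / w y <= K%:R * L.
Proof.
have [P0 P1] := dP; have [w0 w1] := dw.
elim: K => [|K [s Hs]].
  exists [tuple]; rewrite mul0r big1 // => y _.
  by rewrite /h big_nil mul0r subrr expr0n mul0r.
have [x Hx] := @exists_le_mean _ P (fun x => \sum_y h (x :: s) y ^+ 2 / w y) dP.
exists [tuple of x :: s]; apply: (le_trans Hx).
apply: (@le_trans _ _ (\sum_y h s y ^+ 2 / w y + L)); last first.
  by rewrite -natr1 mulrDl mul1r lerD2r.
have hE z y : h (z :: s) y = h s y + (V z y - mu y).
  by rewrite /h big_cons /= -natr1; ring.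
under eq_bigr do rewrite mulr_sumr.
rewrite exchange_big /=.
have bound y : \sum_z P z * (h (z :: s) y ^+ 2 / w y)
    <= h s y ^+ 2 / w y + \sum_z P z * (L * V z y).
  have -> : \sum_z P z * (h (z :: s) y ^+ 2 / w y) =
    h s y ^+ 2 / w y + (\sum_z P z * (V z y ^+ 2 / w y) - mu y ^+ 2 / w y).
    transitivity (\sum_z (P z * (h s y ^+ 2 / w y)
       + (2 * (h s y - mu y) / w y * (P z * V z y)
          - P z * (2 * h s y * mu y / w y - mu y ^+ 2 / w y)
       + P z * (V z y ^+ 2 / w y)))).
      by apply: eq_bigr => z _; rewrite hE; ring.
    rewrite !big_split /= sumrN -!mulr_suml -mulr_sumr P1 -/(mu y); ring.
  rewrite lerD2l lerBlDr; apply: ler_wpDr.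
    by rewrite mulr_ge0 ?sqr_ge0 ?invr_ge0.
  apply: ler_sum => z _; rewrite ler_wpM2l //.
  have [wy|wy] := eqVneq (w y) 0; first by rewrite wy invr0 mulr0 mulr_ge0.
  have wy' : 0 < w y by rewrite lt_def wy w0.
  by rewrite ler_pdivrMr // expr2 mulrAC ler_wpM2r.
apply: (le_trans (ler_sum _ (fun y _ => bound y))).
rewrite big_split /= lerD2l exchange_big /=.
rewrite -[leRHS]mul1r -P1 mulr_suml; apply: ler_sum => z _.
by rewrite -mulr_sumr ler_wpM2l // -mulr_sumr ler_piMr.
Qed.

Lemma quantize (K : nat) (e : R) : (0 < K)%N -> 0 < e -> L <= K%:R * e ^+ 2 ->
  exists s : K.-tuple A, forall E : {set B},
    \sum_(y in E) mu y <= K%:R^-1 * (\sum_(x <- s) \sum_(y in E) V x y) + e.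
Proof.
move=> K0 e0 LK; have [s Hs] := quantize_L2 K; exists s => E.
have [P0 P1] := dP; have [w0 w1] := dw.
have K0' : 0 < K%:R :> R by rewrite ltr0n.
rewrite -(ler_pM2l K0') mulrDr mulVKf ?gt_eqF// -lerBlDl.
have -> : K%:R * \sum_(y in E) mu y - \sum_(x <- s) \sum_(y in E) V x y =
    \sum_(y in E) (K%:R * mu y - \sum_(x <- s) V x y).
  by rewrite sumrB mulr_sumr; congr (_ - _); rewrite exchange_big.
(* AM-GM, with weights making the quadratic and the linear part equal. *)
have amgm y : K%:R * mu y - \sum_(x <- s) V x y <=
    (h s y ^+ 2 / w y / (K%:R * e) + w y * (K%:R * e)) / 2.
  have -> : K%:R * mu y - \sum_(x <- s) V x y = - h s y.
    by rewrite /h size_tuple opprB.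
  have [wy|wy] := eqVneq (w y) 0.
    have Vy x : V x y = 0.
      by apply/eqP; rewrite eq_le V0 andbT (le_trans (VL x y)) // wy mulr0.
    rewrite wy invr0 mulr0 !mul0r addr0 mul0r /h /mu.
    by rewrite !big1 ?mulr0 ?subrr ?oppr0 // => x _; rewrite Vy ?mulr0.
  have wy' : 0 < w y by rewrite lt_def wy w0.
  have t0 : 0 < w y * (K%:R * e) by rewrite !mulr_gt0.
  rewrite -mulrA -invfM; set t := w y * _ in t0 *.
  have : 0 <= (h s y + t) ^+ 2 / t by rewrite mulr_ge0 ?sqr_ge0 ?invr_ge0 ?ltW.
  have -> : (h s y + t) ^+ 2 / t = h s y ^+ 2 / t + 2 * h s y + t.
    by field; rewrite gt_eqF.
  lra.
have pos y : 0 <= (h s y ^+ 2 / w y / (K%:R * e) + w y * (K%:R * e)) / 2.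
  have Ke0 : 0 <= K%:R * e by rewrite mulr_ge0 // ltW.
  apply: divr_ge0 => //; apply: addr_ge0; last exact: mulr_ge0.
  by apply: divr_ge0 => //; apply: divr_ge0; rewrite ?sqr_ge0.
apply: (le_trans (ler_sum _ (fun y _ => amgm y))).
apply: (@le_trans _ _ (\sum_y (h s y ^+ 2 / w y / (K%:R * e) + w y * (K%:R * e)) / 2)).
  by rewrite [leRHS](bigID (mem E)) /= lerDl sumr_ge0.
rewrite -mulr_suml big_split /= -!mulr_suml w1 mul1r.
have : \sum_y h s y ^+ 2 / w y / (K%:R * e) <= K%:R * e.
  rewrite -mulr_suml ler_pdivrMr ?mulr_gt0 //.
  apply: (le_trans Hs); rewrite -mulrA ler_pM2l // mulrCA -expr2.
  by [].
rewrite -mulr_suml; lra.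
Qed.

End Quantization.
End FiniteChannel.

Section IdentificationConverse.
Context {R : realType} {A B : finType}.
Variable W : A -> {ffun B -> R}.
Hypothesis dW : forall x, is_distr (W x).
Variables (lam : R) (M K : nat).
Hypotheses (lam0 : 0 < lam) (M0 : (0 < M)%N) (nocode : ~ code_exists W M lam).
Hypothesis MK : 128 * M%:R <= K%:R * lam ^+ 3.

Lemma partial_resolvability P : is_distr P -> exists s : K.-tuple A,
  forall E : {set B}, 3 / 8 * lam - prob (output W P) (~: E) <=
    K%:R^-1 * \sum_(x <- s) prob (W x) E.
Proof.
move=> dP; pose L := 2 * M%:R / lam.
have M0' : 0 < M%:R :> R by rewrite ltr0n.
have L0 : 0 < L by rewrite divr_gt0 ?mulr_gt0.
have K0 : (0 < K)%N.
  rewrite lt0n; apply/eqP => K0; move: MK; rewrite K0 mul0r leNgt.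
  by rewrite mulr_gt0.
have mass : lam / 2 <= \sum_x P x * prob (W x) (lowinfo W P L x).
  have -> : lam / 2 = lam - M%:R / L.
    by rewrite /L; field; rewrite !gt_eqF.
  rewrite lerBlDr leNgt; apply/negP => small.
  by apply: nocode; apply: (feinstein dW dP L0 small).
pose V x y := W x y * (y \in lowinfo W P L x)%:R.
have W0 x y : 0 <= W x y by case: (dW x).
have V0 x y : 0 <= V x y by rewrite mulr_ge0.
have VW x y : V x y <= W x y by rewrite ler_piMr // lern1 leq_b1.
have V1 x : \sum_y V x y <= 1.
  by case: (dW x) => _ <-; apply: ler_sum => y _; exact: VW.
have VL x y : V x y <= L * output W P y.
  rewrite /V inE; case: (boolP (W x y <= _)) => [WL|_]; first by rewrite mulr1.
  by rewrite mulr0 mulr_ge0 ?(ltW L0) //; case: (output_distr dW dP).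
have e0 : 0 < lam / 8 by rewrite divr_gt0.
have LK : L <= K%:R * (lam / 8) ^+ 2.
  rewrite /L ler_pdivrMr // expr_div_n; move: MK; set l3 := lam ^+ 3.
  have -> : K%:R * (lam ^+ 2 / 8 ^+ 2) * lam = K%:R * l3 / 64 by rewrite /l3; field.
  lra.
have [s Hs] := quantize dP (output_distr dW dP) V0 V1 (ltW L0) VL K0 e0 LK.
exists s => E; apply: (@le_trans _ _ (K%:R^-1 * \sum_(x <- s) \sum_(y in E) V x y));
  last first.
  rewrite ler_wpM2l ?invr_ge0 //; apply: ler_sum => x _.
  by apply: ler_sum => y _; exact: VW.
have EC : \sum_(y in ~: E) \sum_x P x * V x y <= prob (output W P) (~: E).
  apply: ler_sum => y _; rewrite ffunE; apply: ler_sum => x _.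
  by rewrite ler_wpM2l //; case: dP.
have tot : \sum_(y in E) \sum_x P x * V x y + \sum_(y in ~: E) \sum_x P x * V x y
    = \sum_x P x * prob (W x) (lowinfo W P L x).
  transitivity (\sum_y \sum_x P x * V x y).
    rewrite [RHS](bigID (mem E)) /=; congr (_ + _).
    by apply: eq_bigl => y; rewrite inE.
  rewrite exchange_big /=; apply: eq_bigr => x _.
  by rewrite probE mulr_sumr.
move: (Hs E) mass EC tot; lra.
Qed.

Lemma id_converse (I : finType) (Q : I -> {ffun A -> R}) (D : I -> {set B})
    (l1 l2 : R) (J : nat) :
  (forall i, is_distr (Q i)) ->
  (forall i, prob (output W (Q i)) (~: D i) <= l1) ->
  (forall i j, i != j -> prob (output W (Q i)) (D j) <= l2) ->
  l1 <= lam / 16 -> J%:R * l2 <= lam / 16 -> 4 < J.+1%:R * lam ->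
  (#|I| <= J * #|A| ^ K)%N.
Proof.
move=> dQ err1 err2 l1s l2s J4.
have /fin_all_exists[sigma Hs] i := partial_resolvability (dQ i).
rewrite -card_tuple -sum1_card (partition_big sigma predT) //.
rewrite mulnC -sum_nat_const; apply: leq_sum => s _.
rewrite sum1_card leqNgt; apply/negP => /card_geqP[r [r_uniq r_size r_sub]].
have rs i : i \in r -> sigma i = s.
  by move=> /r_sub h; apply/eqP; exact: h.
pose E i := D i :\: (\bigcup_(j in [set j in r | j != i]) D j)%SET.
have out0 i y : 0 <= output W (Q i) y by case: (output_distr dW (dQ i)).
have EC i : i \in r -> prob (output W (Q i)) (~: E i) <= lam / 8.
  move=> ir; apply: (@le_trans _ _ (prob (output W (Q i)) (~: D i) +
      \sum_(j <- rem i r) prob (output W (Q i)) (D j))).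
    rewrite !probE.
    rewrite [X in _ <= _ + X](eq_bigr _ (fun j _ => probE _ _)).
    rewrite exchange_big -big_split /=; apply: ler_sum => y _.
    rewrite -mulr_sumr -mulrDr ler_wpM2l //.
    rewrite /E !inE negb_and negbK; case: (boolP (y \in D i)) => yi /=; last first.
      by rewrite orbT lerDl sumr_ge0.
    rewrite orbF add0r; case: bigcupP => [[j]|_]; last by rewrite sumr_ge0.
    rewrite inE => /andP[jr ji] yj.
    rewrite (big_rem j) /= ?yj ?lerDl ?sumr_ge0 //.
    by rewrite mem_rem_uniq // inE ji.
  apply: (@le_trans _ _ (lam / 16 + J%:R * l2)); last by move: l2s; lra.
  apply: lerD; first exact: le_trans (err1 i) l1s.
  have -> : J%:R * l2 = \sum_(j <- rem i r) l2.
    by rewrite big_const_seq iter_addr_0 count_predT size_rem // r_size mulr_natl.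
  rewrite big_seq [leRHS]big_seq.
  apply: ler_sum => j; rewrite mem_rem_uniq // inE => /andP[ji _].
  by apply: err2; rewrite eq_sym.
have nuE i : i \in r -> lam / 4 <= K%:R^-1 * \sum_(x <- s) prob (W x) (E i).
  move=> ir; have := Hs i (E i); rewrite (rs i ir); have := EC i ir; lra.
have : \sum_(i <- r) lam / 4 <= 1.
  rewrite big_seq; apply: le_trans (ler_sum _ nuE) _.
  rewrite -big_seq -mulr_sumr exchange_big /=.
  have K0 : (0 < K)%N.
    rewrite lt0n; apply/eqP => K0; move: MK; rewrite K0 mul0r leNgt.
    by rewrite mulr_gt0 ?ltr0n.
  rewrite mulrC ler_pdivrMr ?ltr0n // mul1r -[in leRHS](size_tuple s).
  rewrite -sum1_size natr_sum; apply: ler_sum => x _.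
  case: (dW x) => W0 <-.
  rewrite (eq_bigr _ (fun j _ => probE _ _)) exchange_big /=.
  apply: ler_sum => y _; rewrite -mulr_sumr ler_piMr //.
  case: (boolP (has (fun i => y \in E i) r)) => [/hasP[i ir yi]|/hasPn yE]; last first.
    by rewrite big_seq big1 // => i /yE /negbTE ->.
  rewrite (big_rem i) //= yi big_seq big1 ?addr0 // => j.
  rewrite mem_rem_uniq // inE => /andP[ji jr].
  case: (boolP (y \in E j)) => // yj; move: yi yj; rewrite !inE.
  case/andP=> /negP yi _ /andP[_ yj]; case: yi; apply/bigcupP.
  by exists j => //; rewrite inE jr.
rewrite big_const_seq iter_addr_0 count_predT r_size -mulr_natl; lra.
Qed.

End IdentificationConverse.

(** * From Boolean functions to identification *)

Lemma sphere_packing (T q a : nat) : (a <= T)%N -> (0 < q)%N ->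
  exists C : {set {ffun 'I_T -> 'I_q}},
    (forall g h, g \in C -> h \in C -> g != h ->
       (#|[set t | g t == h t]%SET| < a)%N) /\
    (q ^ a <= #|C| * 2 ^ T)%N.
Proof.
move=> aT q0.
pose agree (g h : {ffun 'I_T -> 'I_q}) := [set t | g t == h t]%SET.
pose P (C : {set {ffun 'I_T -> 'I_q}}) := [forall g in C, forall h in C,
  (g != h) ==> (#|agree g h| < a)%N].
have P0 : P finset.set0 by apply/forall_inP => g; rewrite inE.
have [C PC Cmax] := arg_maxnP (fun C : {set _} => #|C|) P0.
exists C; split=> [g h gC hC gh|].
  by move/forall_inP: PC => /(_ g gC)/forall_inP/(_ h hC)/implyP; exact.
have cover h : exists2 g, g \in C & (a <= #|agree g h|)%N.
  case: (boolP [exists g in C, (a <= #|agree g h|)%N]) => [/exists_inP //|].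
  move=> /exists_inPn far.
  have hC : h \notin C.
    apply/negP => /far; rewrite -ltnNge ltnNge => /negP; apply.
    have -> : agree h h = finset.setT by apply/setP => t; rewrite !inE eqxx.
    by rewrite cardsT card_ord.
  have : P (h |: C)%SET.
    have sym g g' : agree g g' = agree g' g.
      by apply/setP => t; rewrite !inE eq_sym.
    apply/forall_inP => g gC'; apply/forall_inP => g' gC''; apply/implyP => gg'.
    move: gC' gC'' gg'; rewrite !inE => /predU1P[->|gC] /predU1P[->|g'C].
    - by rewrite eqxx.
    - by move=> _; rewrite sym ltnNge far.
    - by move=> _; rewrite ltnNge far.
    - by move=> gg'; move/forall_inP: PC => /(_ g gC)/forall_inP/(_ g' g'C)/implyP; exact.
  by move=> /Cmax /=; rewrite cardsU1 hC add1n leqNgt leqnn.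
have ball g : (#|[set h | (a <= #|agree g h|)%N]%SET| <= 2 ^ T * q ^ (T - a))%N.
  have fiber (D : {set 'I_T}) : (\sum_(h in [set h | (a <= #|agree g h|)%N]%SET | agree g h == D) 1
      <= q ^ (T - a))%N.
    rewrite sum1_card.
    have [Da|aD] := ltnP #|D| a.
      rewrite eq_card0 // => h; rewrite unfold_in inE; apply/negP => /andP[agr /eqP hD].
      by move: Da; rewrite -hD ltnNge agr.
    pose F t : pred 'I_q := if t \in D then pred1 (g t) else predT.
    apply: (@leq_trans #|family F|).
      apply: subset_leq_card; apply/fintype.subsetP => h; rewrite unfold_in => /andP[_ /eqP hD].
      apply/familyP => t; rewrite /F; case: ifP => // tD.
      by rewrite inE; move: tD; rewrite -hD inE eq_sym.
    rewrite card_family foldrE big_image /=.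
    rewrite (eq_bigr (fun t => if t \notin D then q else 1%N)); last first.
      by move=> t _; rewrite /F; case: (t \in D); rewrite ?card1 // card_ord.
    rewrite -big_mkcond prod_nat_const leq_pexp2l //.
    have -> : #|[pred t | t \notin D]| = (T - #|D|)%N.
      have := cardsC D; rewrite card_ord => cD; rewrite -[X in (X - _)%N]cD addKn.
      by apply: eq_card => t; rewrite !inE.
    exact: leq_sub2l.
  rewrite -sum1_card (partition_big (agree g) predT) //.
  have <- : #|{set 'I_T}| = (2 ^ T)%N by rewrite -cardsT -powersetT card_powerset cardsT card_ord.
  by rewrite -sum_nat_const; apply: leq_sum => D _; exact: fiber.
have total : (q ^ T <= #|C| * (2 ^ T * q ^ (T - a)))%N.
  have -> : (q ^ T)%N = #|{ffun 'I_T -> 'I_q}| by rewrite card_ffun !card_ord.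
  rewrite -sum_nat_const; apply: leq_trans (leq_sum _ (fun g _ => ball g)).
  under eq_bigr do rewrite -sum1_card.
  rewrite (exchange_big_dep predT) //= -sum1_card; apply: leq_sum => h _.
  have [g gC gh] := cover h.
  by rewrite (bigD1 g) /= ?inE ?gC.
rewrite -(@leq_pmul2r (q ^ (T - a))) ?expn_gt0 ?q0 //.
by rewrite -expnD subnKC // -mulnA.
Qed.

Lemma weight_family (m S T q : nat) : (T <= S)%N -> (T * q + (S - T) <= 2 ^ m)%N ->
  exists (emb : 'I_T * 'I_q -> m.-tuple bool) (f : {ffun 'I_T -> 'I_q} -> bfun m),
    (forall g, hweight (f g) = S) /\
    (forall g t c, f g (emb (t, c)) = (g t == c)).
Proof.
move=> TS fit; pose Z := ('I_T * 'I_q + 'I_(S - T))%type.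
have cardZ : (#|{: Z}| <= #|{: m.-tuple bool}|)%N.
  by rewrite card_sum card_prod !card_ord card_tuple card_bool.
pose e (z : Z) : m.-tuple bool := enum_val (widen_ord cardZ (enum_rank z)).
have e_inj : injective e.
  move=> z z' /enum_val_inj/(congr1 val) /= zz'.
  by apply: enum_rank_inj; apply: val_inj.
pose sel (g : {ffun 'I_T -> 'I_q}) (z : Z) :=
  if z is inl tc then g tc.1 == tc.2 else true.
exists (e \o inl), (fun g => [ffun i => [exists z, (e z == i) && sel g z]]); split.
  move=> g; rewrite /hweight.
  transitivity #|[set e z | z in [set z | sel g z]%SET]%SET|.
    apply: eq_card => i; apply/idP/imsetP => [/set_mem|[z]].
      by rewrite /= ffunE => /existsP[z /andP[/eqP <- sz]]; exists z; rewrite // inE.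
    rewrite inE => sz ->; apply/mem_set; rewrite /= ffunE; apply/existsP.
    by exists z; rewrite eqxx.
  rewrite card_imset // -sum1_card.
  rewrite (eq_bigl (sel g)) => [|z]; last by rewrite inE.
  rewrite big_sumType /= -(pair_big_dep xpredT (fun t c => g t == c) (fun _ _ => 1%N)) /=.
  rewrite [X in (_ + X)%N]sum1_card card_ord (eq_bigr (fun=> 1%N)) => [|t _].
    by rewrite sum1_card card_ord subnKC.
  by rewrite (big_pred1 (g t)) // => c; rewrite eq_sym.
move=> g t c; rewrite ffunE /=; apply/existsP/idP => [[z]|gtc].
  by case/andP=> /eqP/e_inj ->.
by exists (inl (t, c)); rewrite eqxx.
Qed.

Lemma bfc_converse (R : realType) (X Y : finType) (W : channel R X Y)
    (HW : is_channel W) (n m S T p h J K M : nat) (lam l1 l2 : R)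
    (Q : m.-tuple bool -> {ffun n.-tuple X -> R})
    (D : bfun m -> {set n.-tuple Y}) :
  is_bfc_code W (weight_class S) Q D l1 l2 ->
  0 < lam -> (0 < M)%N -> ~ code_exists (W n) M lam ->
  128 * M%:R <= K%:R * lam ^+ 3 -> 4 < J.+1%:R * lam ->
  l1 <= lam / 16 -> 0 <= l2 -> J%:R * (l2 + h%:R^-1) <= lam / 16 -> (1 < h)%N ->
  (0 < T)%N -> (T <= S)%N -> (T * 2 ^ p + (S - T) <= 2 ^ m)%N -> (2 * h <= p)%N ->
  (p * T <= 2 * h * (J + K * (n * #|X|)))%N.
Proof.
move=> [dQ code] lam0 M0 nocode MK J4 l1s l20 l2s h1 T0 TS fit hp.
have dW := @HW n.
have h0 : (0 < h)%N := ltnW h1.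
have [emb [f [wf fE]]] := weight_family TS fit.
have [C [Cfar Cbig]] := @sphere_packing T (2 ^ p) (T %/ h).+1
  (ltn_Pdiv h1 T0) (expn_gt0 2 p).
have T0' : 0 < T%:R :> R by rewrite ltr0n.
pose P (g : {ffun 'I_T -> 'I_(2 ^ p)}) : {ffun n.-tuple X -> R} :=
  [ffun x => T%:R^-1 * \sum_t Q (emb (t, g t)) x].
have dP g : is_distr (P g).
  split=> [x|].
    rewrite ffunE mulr_ge0 ?invr_ge0 // sumr_ge0 // => t _.
    by case: (dQ (emb (t, g t))).
  under eq_bigr do rewrite ffunE.
  rewrite -mulr_sumr exchange_big /=.
  rewrite (eq_bigr (fun=> 1)) => [|t _]; last by case: (dQ (emb (t, g t))).
  by rewrite sumr_const card_ord mulVf ?gt_eqF.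
have outP g E : prob (output (W n) (P g)) E
    = T%:R^-1 * \sum_t QW W (Q (emb (t, g t))) E.
  rewrite prob_output exchange_big mulr_sumr /=; apply: eq_bigr => x _.
  by rewrite ffunE -mulrA -mulr_suml.
have QWout i E : QW W (Q i) E = prob (output (W n) (Q i)) E by rewrite prob_output.
have mean_le (F : 'I_T -> R) c : (forall t, F t <= c) -> T%:R^-1 * \sum_t F t <= c.
  move=> Fc; rewrite mulrC ler_pdivrMr // mulr_natr -[X in c *+ X]card_ord -sumr_const.
  by apply: ler_sum => t _.
have inclass g : f g \in weight_class S by rewrite inE wf.
have err1 g : prob (output (W n) (P g)) (~: D (f g)) <= l1.
  rewrite outP; apply: mean_le => t.
  by have [+ _] := code (emb (t, g t)) _ (inclass g); apply; rewrite fE.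
have err2 g g' : g \in C -> g' \in C -> g != g' ->
    prob (output (W n) (P g)) (D (f g')) <= l2 + h%:R^-1.
  move=> gC g'C gg'; rewrite outP.
  apply: (@le_trans _ _ (T%:R^-1 * \sum_t (l2 + (g t == g' t)%:R))).
    rewrite ler_wpM2l ?invr_ge0 //; apply: ler_sum => t _.
    have [eqt|neqt] := boolP (g t == g' t).
      by rewrite ler_wpDl // QWout; apply: prob_le1; apply: output_distr.
    rewrite addr0; have [_ +] := code (emb (t, g t)) _ (inclass g'); apply.
    by rewrite fE eq_sym.
  rewrite big_split /= sumr_const card_ord mulrDr -[l2 *+ T]mulr_natl mulKf ?gt_eqF //.
  rewrite lerD2l mulrC ler_pdivrMr // mulrC ler_pdivlMr ?ltr0n //.
  have -> : \sum_t (g t == g' t)%:R = #|[set t | g t == g' t]%SET|%:R :> R.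
    by rewrite -sum1_card natr_sum [RHS]big_mkcond; apply: eq_bigr => t _; rewrite inE; case: eqP.
  rewrite -natrM ler_nat.
  apply: leq_trans (leq_divM T h); rewrite leq_mul2r -ltnS; apply/orP; right.
  exact: Cfar.
have card_id : (#|C| <= J * #|{: n.-tuple X}| ^ K)%N.
  rewrite -(card_sig (mem C)).
  apply: (id_converse dW lam0 M0 nocode MK (Q := fun g => P (val g))
    (D := fun g => D (f (val g))) _ _ _ l1s l2s J4) => //.
  by move=> g g' gg'; apply: err2 => //; apply: valP.
have bits : (p * (T %/ h).+1 <= J + K * (n * #|X|) + T)%N.
  rewrite -(@leq_exp2l 2) // expnM; apply: (leq_trans Cbig).
  rewrite [in leqRHS]expnD leq_mul2r expn_eq0 /=.
  apply: (leq_trans card_id); rewrite expnD leq_mul ?(ltnW (ltn_expl _ _)) //.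
  rewrite card_tuple -expnM mulnCA mulnA [in leqRHS]mulnC [in leqRHS]expnM.
  have [->|nK0] := posnP (n * K); first by rewrite !expn0.
  by rewrite leq_exp2r // ltnW // ltn_expl.
have Th : (T <= h * (T %/ h).+1)%N by rewrite mulnC ltnW // ltn_ceil.
nia.
Qed.

(** * Asymptotics *)

Section Growth.
Context {R : realType}.
Implicit Types (a c x y z : R).

Let ln20 : 0 < ln 2 :> R.
Proof. by rewrite ln_gt0 // ltr1n. Qed.

Lemma log2_powR x a : log2 (x `^ a) = a * log2 x.
Proof. by rewrite /log2 ln_powR mulrA. Qed.

Lemma powR2E x : 2 `^ x = expR (x * ln 2).
Proof. by rewrite /powR gt_eqF // ltr0n. Qed.

Lemma powR2_le x y : 0 < x -> (2 `^ y <= x) = (y <= log2 x).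
Proof.
by move=> x0; rewrite powR2E -{1}(lnK x0) ler_expR /log2 ler_pdivlMr.
Qed.

Lemma powR2_ge x y : 0 < x -> (x <= 2 `^ y) = (log2 x <= y).
Proof.
by move=> x0; rewrite powR2E -{1}(lnK x0) ler_expR /log2 ler_pdivrMr.
Qed.

Lemma log2K x : 0 < x -> 2 `^ (log2 x) = x.
Proof. by move=> x0; apply/eqP; rewrite eq_le powR2_le // powR2_ge // lexx. Qed.

Lemma log2_ge0 x : 1 <= x -> 0 <= log2 x.
Proof. by move=> x1; rewrite /log2 divr_ge0 ?ln_ge0 // ler1n. Qed.

Lemma powR2D x y : 2 `^ (x + y) = 2 `^ x * 2 `^ y :> R.
Proof. by rewrite powRD //; apply/implyP => _; rewrite pnatr_eq0. Qed.

Lemma powR2_ge1 x : 0 <= x -> 1 <= 2 `^ x.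
Proof. by move=> x0; rewrite -[leLHS](powRr0 2) ler_powR // ler1n. Qed.

Lemma powR_unbounded a c : 0 < a ->
  exists N : nat, forall n : nat, (N <= n)%N -> c <= n%:R `^ a.
Proof.
move=> a0; exists (Num.truncn (Num.max c 1 `^ a^-1)).+1 => n Nn.
have c0 : 0 <= Num.max c 1 by rewrite le_max ler01 orbT.
apply: (@le_trans _ _ (Num.max c 1)); first by rewrite le_max lexx.
rewrite -[leLHS]powRr1 // -[X in _ `^ X <= _](mulVf (lt0r_neq0 a0)) powRrM.
apply: ge0_ler_powR; rewrite ?nnegrE ?powR_ge0 ?(ltW a0) //.
by apply/ltW/(lt_le_trans (truncnS_gt _)); rewrite ler_nat.
Qed.

Lemma linear_lt_powR2 a c : 0 < a -> exists N : nat, forall n : nat, (N <= n)%N ->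
  c * (n%:R + 1) < 2 `^ (n%:R * a).
Proof.
move=> a0; pose b := a / 2 * ln 2.
have b0 : 0 < b by rewrite /b !mulr_gt0 // invr_gt0.
pose k := Num.max c 1; have k0 : 0 < k by rewrite lt_max ltr01 orbT.
exists (Num.truncn (2 * k / b ^+ 2)).+1 => n Nn.
have n1 : 1 <= n%:R :> R by rewrite ler1n (leq_ltn_trans _ Nn).
have kn : 2 * k < n%:R * b ^+ 2.
  rewrite -ltr_pdivrMr ?exprn_gt0 //; apply: (lt_le_trans (truncnS_gt _)).
  by rewrite ler_nat.
apply: (@le_lt_trans _ _ (k * (n%:R + 1))).
  by rewrite ler_wpM2r ?addr_ge0 // le_max lexx.
apply: (@lt_le_trans _ _ ((n%:R * b) ^+ 2)).
  apply: (@le_lt_trans _ _ (2 * k * n%:R)); last first.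
    have -> : (n%:R * b) ^+ 2 = n%:R * b ^+ 2 * n%:R by ring.
    by rewrite ltr_pM2r // (lt_le_trans ltr01).
  have -> : 2 * k * n%:R = k * (2 * n%:R) by ring.
  by rewrite ler_wpM2l ?(ltW k0) //; lra.
have -> : n%:R * a = n%:R * (a / 2) + n%:R * (a / 2) :> R by field.
rewrite powR2D -expr2; apply: lerXn2r; rewrite ?nnegrE ?powR_ge0 //; first by rewrite mulr_ge0 // ltW.
rewrite powR2E; apply: le_trans (expR_ge1Dx _).
by rewrite /b mulrA lerDr.
Qed.

Lemma log2_le_powR a c : 0 < a -> 0 < c ->
  exists N : nat, forall n : nat, (N <= n)%N -> log2 n%:R <= c * n%:R `^ a.
Proof.
move=> a0 c0; have a20 : 0 < a / 2 by rewrite divr_gt0.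
pose k := (c * (a / 2 * ln 2))^-1.
have [N HN] := @powR_unbounded (a / 2) k a20.
exists N.+1 => n Nn; have n0 : 0 < n%:R :> R by rewrite ltr0n (leq_ltn_trans _ Nn).
have ad : 0 < a / 2 * ln 2 by rewrite mulr_gt0.
have := HN n (ltnW Nn); set t := n%:R `^ (a / 2) => kt.
have -> : n%:R `^ a = t * t.
  rewrite /t -powRD; last by apply/implyP => _; rewrite gt_eqF.
  by congr (_ `^ _); field.
have t0 : 0 < t by rewrite powR_gt0.
apply: (@le_trans _ _ (t / (a / 2 * ln 2))).
  have := ltW (ln_sublinear t0); rewrite /t ln_powR -/t => h.
  by rewrite ler_pdivlMr // /log2 mulrCA divfK ?gt_eqF // mulrC.
rewrite ler_pdivrMr //; move: kt; rewrite /k -div1r ler_pdivrMr ?mulr_gt0 // => kt.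
rewrite -[leLHS]mul1r; have -> : c * (t * t) * (a / 2 * ln 2) = t * (c * (a / 2 * ln 2)) * t by ring.
by rewrite ler_wpM2r // ltW.
Qed.

End Growth.

Section Transfer.
Context {R : realType} {X Y : finType}.
Variable W : channel R X Y.
Hypothesis HW : is_channel W.

(* Room for [T] blocks of [2 ^ p] messages and [S m - T] further messages. *)
Definition supports (S : nat -> nat) (m p T : nat) : Prop :=
  [/\ (0 < T)%N, (T <= S m)%N & (T * 2 ^ p + (S m - T) <= 2 ^ m)%N].

(* For a code with [m > L (r - g') n], the weight [S m] leaves room for blocks
   with [p * T] at least [2 ^ (n (rho - g))]. *)
Definition forces_rate (L : R -> nat -> R) (S : nat -> nat) (r rho : R) : Prop :=
  forall (g : R) (h : nat), 0 < g -> g < rho -> exists2 g', 0 < g' &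
    exists N : nat, forall n m : nat, (N <= n)%N -> L (r - g') n < m%:R ->
      exists p T : nat, [/\ supports S m p T, (h <= p)%N &
        2 `^ (n%:R * (rho - g)) <= (p * T)%:R :> R].

Lemma achievable_transfer L S r rho : 0 < rho -> forces_rate L S r rho ->
  achievable_comp_rate W L (fun m => @weight_class m (S m)) r ->
  achievable_rate W rho.
Proof.
move=> rho0 force ach lam g lam0 g0.
pose g1 := Num.min g (rho / 2).
have g10 : 0 < g1 by rewrite lt_min g0 divr_gt0.
have g1g : g1 <= g by rewrite ge_min lexx.
have g1rho : g1 <= rho / 2 by rewrite ge_min lexx orbT.
have g20 : 0 < g1 / 2 by rewrite divr_gt0.
have g2rho : g1 / 2 < rho by lra.
pose J := (Num.truncn (4 / lam)).+1.
pose h := (Num.truncn (32 * J%:R / lam)).+2.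
pose k := (Num.truncn (128 / lam ^+ 3)).+1.
pose l2 := lam / (32 * J%:R).
have J0 : 0 < J%:R :> R by rewrite ltr0n.
have h0 : 0 < h%:R :> R by rewrite ltr0n.
have l20 : 0 < l2 by rewrite divr_gt0 ?mulr_gt0.
have l10 : 0 < lam / 16 by rewrite divr_gt0.
have J4 : 4 < J.+1%:R * lam.
  rewrite -ltr_pdivrMr //; apply: (lt_trans (truncnS_gt _)).
  by rewrite ltr_nat.
have hJ : J%:R * (l2 + h%:R^-1) <= lam / 16.
  have -> : J%:R * (l2 + h%:R^-1) = lam / 32 + J%:R / h%:R.
    by rewrite /l2; field; rewrite !gt_eqF.
  suff : J%:R / h%:R <= lam / 32 by lra.
  have : 32 * J%:R / lam < h%:R.
    by apply: (lt_trans (truncnS_gt _)); rewrite ltr_nat.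
  rewrite ltr_pdivrMr // ler_pdivrMr //; lra.
have k128 : 128 <= k%:R * lam ^+ 3.
  by rewrite -ler_pdivrMr ?exprn_gt0 //; apply/ltW/truncnS_gt.
have [g' g'0 [N1 force1]] := force _ (2 * h)%N g20 g2rho.
have [N2 code] := ach _ _ _ l10 l20 g'0.
pose c := (4 * h * (J + k * #|X|))%N.
have [N3 large] := @linear_lt_powR2 R (g1 / 2) c%:R g20.
exists (maxn N1 (maxn N2 N3)) => n; rewrite !geq_max => /and3P[n1 n2 n3].
have [m [mL [Q [D codeQD]]]] := code n n2.
have [p [T [[T0 TS fit] hp pT]]] := force1 n m n1 mL.
pose e : R := 2 `^ (n%:R * (rho - g1)).
have e1 : 1 <= e by rewrite powR2_ge1 // mulr_ge0 // subr_ge0; lra.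
pose M := (Num.truncn e).+1.
have eM : e <= M%:R by apply/ltW/truncnS_gt.
have M2e : M%:R <= 2 * e.
  have : (Num.truncn e)%:R <= e by rewrite truncn_le (le_trans ler01).
  rewrite /M -natr1; lra.
have M0 : (0 < M)%N by [].
exists M; split.
  apply: le_trans eM; rewrite ler_powR ?ler1n // ler_wpM2l //; lra.
suff : code_exists (@W n) M lam by [].
have [//|nocode] := pselect (code_exists (@W n) M lam).
have MK : 128 * M%:R <= (k * M)%:R * lam ^+ 3.
  by rewrite natrM mulrAC ler_wpM2r.
have := bfc_converse HW codeQD lam0 M0 nocode MK J4 (lexx _) (ltW l20) hJ isT T0 TS fit hp.
move=> small; exfalso.
have : (p * T <= h * (2 * (J + k * #|X|)) * M * (n + 1))%N.
  apply: (leq_trans small).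
  have -> : (h * (2 * (J + k * #|X|)) * M * (n + 1)
      = 2 * h * ((J + k * #|X|) * (M * (n + 1))))%N by ring.
  rewrite leq_mul2l [X in _ || (_ <= X)%N]mulnDl leq_add ?orbT //.
    by rewrite leq_pmulr // muln_gt0 M0 addn1.
  have -> : (k * M * (n * #|X|) = k * #|X| * (M * n))%N by ring.
  by rewrite !leq_mul2l leq_addr !orbT.
rewrite -(ler_nat R) => /(le_trans pT); rewrite leNgt => /negP; apply.
have -> : n%:R * (rho - g1 / 2) = n%:R * (rho - g1) + n%:R * (g1 / 2) :> R by field.
rewrite powR2D -/e.
apply: (@le_lt_trans _ _ (e * (c%:R * (n%:R + 1)))); last first.
  by rewrite ltr_pM2l ?(lt_le_trans ltr01) // large.
have -> : (h * (2 * (J + k * #|X|)) * M * (n + 1))%:R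
   = M%:R * ((h * (2 * (J + k * #|X|)))%:R * (n%:R + 1)) :> R.
  by rewrite !natrM !natrD; ring.
have -> : e * (c%:R * (n%:R + 1)) = 2 * e * ((h * (2 * (J + k * #|X|)))%:R * (n%:R + 1)).
  by rewrite /c !natrM !natrD; ring.
by rewrite ler_wpM2r // mulr_ge0 // addr_ge0.
Qed.

Lemma shannon_capacity_ge0 L Fam r :
  achievable_comp_rate W L Fam r -> (0 <= shannon_capacity W)%E.
Proof.
move=> /(_ 1 1 1 ltr01 ltr01 ltr01)[N code].
apply: ereal_sup_ubound; exists 0 => // lam g lam0 g0; exists N => n Nn.
have [m [_ [Q [D [dQ _]]]]] := code n Nn.
have [x _] := distr_inhabited (dQ [tuple of nseq m true]).
exists 1%N; split.
  rewrite -[leRHS](powRr0 2) ler_powR ?ler1n // sub0r mulrN oppr_le0.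
  by rewrite mulr_ge0 // ltW.
exists (fun=> x), (fun=> finset.setT); split=> [j j'|j]; first by rewrite !ord1 eqxx.
by rewrite finset.setCT /Wprob big_set0 ltW.
Qed.

Lemma achievable_le_capacity r : achievable_rate W r -> (r%:E <= shannon_capacity W)%E.
Proof. by move=> ach; apply: ereal_sup_ubound; exists r. Qed.

End Transfer.

Section WeightGrowth.
Context {R : realType}.
Implicit Types (b c d g r rho : R) (L : R -> nat -> R) (e s : nat -> R).

Lemma constant_forces_rate (c : nat) r : (0 < c)%N -> 0 < r ->
  forces_rate (fun r n => 2 `^ (r * n%:R)) (fun=> c) r r.
Proof.
move=> c0 r0 g h g0 gr; have g20 : 0 < g / 2 by rewrite divr_gt0.
exists (g / 2) => //.
have [N large] := linear_lt_powR2 (c + h).+2%:R g20.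
exists N => n m /large {}large mL; exists m.-1, 1%N.
have ge2 : (c + h).+2%:R <= 2 `^ (n%:R * (g / 2)) :> R.
  by apply/ltW/(le_lt_trans _ large); rewrite ler_peMr // lerDr.
have split : (r - g / 2) * n%:R = n%:R * (r - g) + n%:R * (g / 2) by field.
have b1 : 1 <= 2 `^ (n%:R * (r - g)) by rewrite powR2_ge1 // mulr_ge0 // subr_ge0 ltW.
move: mL; rewrite split powR2D; move: ge2 b1.
set u := 2 `^ (n%:R * (g / 2)); set v := 2 `^ (n%:R * (r - g)) => ge2 v1 mL.
have uv : u <= v * u by rewrite ler_peMl // (le_trans _ ge2).
have mbig : ((c + h).+2 < m)%N by rewrite -(ltr_nat R); lra.
have [m1 hm cm mE] : [/\ (0 < m)%N, (h <= m.-1)%N, (c <= m.-1)%N & m = m.-1.+1].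
  by clear -mbig; split; lia.
split; [split|..] => //.
  rewrite mul1n [in leqRHS]mE expnS mul2n -addnn leq_add2l.
  by rewrite (leq_trans (leq_subr _ _)) // (leq_trans cm) // ltnW // ltn_expl.
have u2 : 2 <= u by apply: le_trans ge2; rewrite ler_nat.
have v2u : 2 * v <= v * u by rewrite mulrC ler_wpM2l // (le_trans ler01).
rewrite muln1 -subn1 natrB //; lra.
Qed.

Lemma polynomial_forces_rate c b r : 0 < c -> 0 < b -> 0 < r ->
  forces_rate (fun r n => 2 `^ (r * n%:R))
    (fun m => Num.truncn (c * m%:R `^ b)) r (r * (1 + b)).
Proof.
move=> c0 b0 r0 g h g0 gr; have b1 : 0 < 1 + b by rewrite addr_gt0.
have r20 : 0 < r / 2 by rewrite divr_gt0.
have g20 : 0 < g / 2 by rewrite divr_gt0.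
pose g' := g / (2 * (1 + b)); exists g'; first by rewrite divr_gt0 ?mulr_gt0.
have g'r : r / 2 <= r - g'.
  suff : g' <= r / 2 by lra.
  by rewrite /g' ler_pdivrMr ?mulr_gt0 //; lra.
have [M1 c1] := @powR_unbounded R b c^-1 b0.
have b40 : 0 < (4 * b)^-1 by rewrite invr_gt0 mulr_gt0.
have [M2 logm] := @log2_le_powR R 1 (4 * b)^-1 ltr01 b40.
pose M3 := (Num.truncn (4 * `|log2 c|)).+1.
pose m0 := maxn (maxn M1 M2) (maxn M3 (2 * h + 6)).
have [N1 large] := @linear_lt_powR2 R (r / 2) m0%:R r20.
have [N2 slack] := @linear_lt_powR2 R (g / 2) (6 / c) g20.
exists (maxn N1 N2) => n m; rewrite geq_max => /andP[/large {}large /slack {}slack] mL.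
have mm0 : (m0 <= m)%N.
  rewrite -(ler_nat R); apply/ltW/(le_lt_trans _ mL)/ltW/(le_lt_trans _ (lt_le_trans large _)).
    by rewrite ler_peMr // lerDr.
  by rewrite ler_powR ?ler1n // mulrC ler_wpM2r.
move: (mm0); rewrite !geq_max => /andP[/andP[/c1 {}c1 /logm {}logm] /andP[mM3 mh]].
have [m_gt0 hm half3] : [/\ (0 < m)%N, (h <= m./2)%N & (m <= 3 * m./2)%N].
  by clear -mh; split; lia.
have half_le : (m <= 2 * (m - m./2))%N by clear; lia.
have half_lt : (m./2 <= m)%N by clear; lia.
have m0' : 0 < m%:R :> R by rewrite ltr0n.
pose s := c * m%:R `^ b; pose T := Num.truncn s.
have s1 : 1 <= s by rewrite /s -ler_pdivrMl // mulr1.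
have Ts : T%:R <= s by rewrite truncn_le (le_trans ler01).
have sT : s < T%:R + 1 by rewrite natr1 truncnS_gt.
have T1 : (0 < T)%N by rewrite truncn_gt0.
have s_le : s <= (2 ^ (m - m./2))%:R.
  rewrite natrX -powR_mulrn // powR2_ge ?(lt_le_trans ltr01) //.
  rewrite /s /log2 lnM ?posrE ?powR_gt0 // mulrDl -!/(log2 _) log2_powR.
  have : b * log2 m%:R <= m%:R / 4.
    have -> : m%:R / 4 = b * ((4 * b)^-1 * m%:R `^ 1) by rewrite powRr1 ?ltW //; field; rewrite gt_eqF.
    by rewrite ler_pM2l.
  have : 4 * `|log2 c| <= m%:R.
    by apply/ltW/(lt_le_trans (truncnS_gt _)); rewrite ler_nat.
  have := ler_norm (log2 c).
  move: half_le; rewrite -(ler_nat R) natrM; lra.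
exists m./2, T; split; [split => //| exact: hm |].
  rewrite subnn addn0 -[X in (_ <= 2 ^ X)%N](@subnK m./2) //.
  by rewrite expnD leq_mul2r -(ler_nat R) (le_trans Ts) ?orbT.
have sE : m%:R * s = c * m%:R `^ (1 + b).
  rewrite /s powRD; last by apply/implyP => _; rewrite gt_eqF.
  by rewrite powRr1 ?ltW //; ring.
have mpow : 2 `^ (n%:R * (r * (1 + b) - g)) * 2 `^ (n%:R * (g / 2)) <= m%:R `^ (1 + b).
  rewrite -powR2D; apply: (@le_trans _ _ ((2 `^ ((r - g') * n%:R)) `^ (1 + b))).
    rewrite -powRrM ler_powR ?ler1n // le_eqVlt; apply/orP; left; apply/eqP.
    by rewrite /g'; field; rewrite gt_eqF.
  by apply: ge0_ler_powR; rewrite ?nnegrE ?powR_ge0 // ltW.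
have slack6 : 6 / c <= 2 `^ (n%:R * (g / 2)).
  by apply/ltW/(le_lt_trans _ slack); rewrite ler_peMr ?lerDr // divr_ge0 // ltW.
have v0 : 0 <= 2 `^ (n%:R * (r * (1 + b) - g)) by rewrite powR_ge0.
have := le_trans (ler_wpM2l v0 slack6) mpow.
set v := 2 `^ _ in v0 *.
rewrite mulrA ler_pdivrMr // [X in _ <= X]mulrC -sE => vs.
have m3 : m%:R <= 3 * (m./2)%:R :> R by rewrite -natrM ler_nat.
have : m%:R * s <= 3 * (m./2)%:R * (2 * T%:R).
  have : 1 <= T%:R :> R by rewrite ler1n.
  by move=> ?; apply: ler_pM => //; [rewrite (le_trans ler01) | lra].
rewrite natrM; lra.
Qed.

Lemma exponential_forces_rate L s e c d r rho : 0 < c -> d < 1 ->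
  (exists m0 : nat, forall m, (m0 <= m)%N ->
     [/\ s m = c * 2 `^ (e m), e m <= m%:R & c * 2 `^ (e m) <= d * 2 `^ m%:R]) ->
  (forall g, 0 < g -> g < rho -> exists2 g', 0 < g' &
     forall k : nat, exists N : nat, forall n m : nat, (N <= n)%N ->
       L (r - g') n < m%:R -> (k <= m)%N /\ n%:R * (rho - g) <= e m) ->
  forces_rate L (fun m => Num.truncn (s m)) r rho.
Proof.
move=> c0 d1 [m0 Hm] He g h g0 gr; have g20 : 0 < g / 2 by rewrite divr_gt0.
pose p := h.+1; pose c' := Num.min c ((1 - d) / 2 ^+ p).
have p20 : 0 < 2 ^+ p :> R by rewrite exprn_gt0.
have c'0 : 0 < c' by rewrite lt_min c0 divr_gt0 // subr_gt0.
have g2rho : g / 2 < rho by lra.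
have [g' g'0 {}He] := He _ g20 g2rho; exists g' => //.
have [N1 force1] := He m0; have [N2 slack] := linear_lt_powR2 (2 / c') g20.
exists (maxn N1 N2) => n m; rewrite geq_max => /andP[n1 /slack {}slack] mL.
have [/Hm[sE em cd] ne] := force1 n m n1 mL.
rewrite /supports sE; set x := 2 `^ (e m) in cd *.
have x0 : 0 < x by rewrite powR_gt0.
pose v := 2 `^ (n%:R * (rho - g)).
have v1 : 1 <= v by rewrite powR2_ge1 // mulr_ge0 // subr_ge0 ltW.
have vx : 2 * v <= c' * x.
  have -> : 2 * v = c' * (v * (2 / c')) by field; rewrite gt_eqF.
  rewrite ler_pM2l //.
  apply: (@le_trans _ _ (v * 2 `^ (n%:R * (g / 2)))).
    rewrite ler_wpM2l ?(le_trans ler01) //.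
    by apply/ltW/(le_lt_trans _ slack); rewrite ler_peMr ?lerDr // divr_ge0 // ltW.
  rewrite -powR2D ler_powR ?ler1n //; apply: le_trans ne.
  by rewrite le_eqVlt; apply/orP; left; apply/eqP; field.
pose T := Num.truncn (c' * x).
have Tle : T%:R <= c' * x by rewrite truncn_le mulr_ge0 ?ltW.
have Tgt : c' * x < T%:R + 1 by rewrite natr1 truncnS_gt.
have T1 : (0 < T)%N by rewrite truncn_gt0; lra.
have cc' : c' <= c by rewrite ge_min lexx.
have Sle : (Num.truncn (c * x))%:R <= c * x by rewrite truncn_le mulr_ge0 ?ltW.
exists p, T; split; [split => // | exact: leqnSn | ].
- by apply: le_truncn; rewrite ler_wpM2r // ltW.
- apply: (@leq_trans (T * 2 ^ p + Num.truncn (c * x))); first by rewrite leq_add2l leq_subr.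
  rewrite -(ler_nat R) natrD natrM !natrX.
  have : T%:R * 2 ^+ p <= (1 - d) * x.
    apply: (@le_trans _ _ (c' * x * 2 ^+ p)); first by rewrite ler_wpM2r // ltW.
    rewrite mulrAC ler_wpM2r ?(ltW x0) //.
    by rewrite -ler_pdivlMr // ge_min lexx orbT.
  have : (1 - d) * x <= (1 - d) * 2 ^+ m.
    by rewrite ler_wpM2l ?subr_ge0 ?(ltW d1) // -powR_mulrn // ler_powR ?ler1n.
  move: cd; rewrite powR_mulrn //; lra.
have : T%:R <= (p * T)%:R :> R by rewrite ler_nat leq_pmull.
by rewrite -/v; lra.
Qed.

End WeightGrowth.

Section ExponentialWeights.
Context {R : realType}.
Implicit Types (b c d g r rho : R) (L : R -> nat -> R) (e s : nat -> R).

Lemma sublinear_exponent_forces_rate L e c th r rho : 0 < c -> th < 1 ->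
  (exists m0 : nat, forall m, (m0 <= m)%N -> e m <= th * m%:R) ->
  (forall g, 0 < g -> g < rho -> exists2 g', 0 < g' &
     forall k : nat, exists N : nat, forall n m : nat, (N <= n)%N ->
       L (r - g') n < m%:R -> (k <= m)%N /\ n%:R * (rho - g) <= e m) ->
  forces_rate L (fun m => Num.truncn (c * 2 `^ (e m))) r rho.
Proof.
move=> c0 th1 [m0 He]; apply: (exponential_forces_rate (e := e) (d := 2^-1) c0).
  by rewrite invf_lt1 ?ltr1n.
exists (maxn m0 (Num.truncn ((log2 c + 1) / (1 - th))).+1) => m.
rewrite geq_max => /andP[/He em mc].
have {}mc : log2 c + 1 <= m%:R * (1 - th).
  rewrite -ler_pdivrMr ?subr_gt0 //.
  by apply/ltW/(lt_le_trans (truncnS_gt _)); rewrite ler_nat.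
split=> //; first by apply: (le_trans em); rewrite ler_piMl // ltW.
rewrite -[c in c * _]log2K // -powR2D -powR_inv1 // -powR2D ler_powR ?ler1n //.
lra.
Qed.

Lemma quasipolynomial_forces_rate c r : 0 < c -> 0 < r ->
  forces_rate (fun r n => 2 `^ (r * Num.sqrt n%:R))
    (fun m => Num.truncn (c * m%:R `^ log2 m%:R)) r (r ^+ 2).
Proof.
move=> c0 r0.
have -> : (fun m : nat => Num.truncn (c * m%:R `^ log2 m%:R)) =
    (fun m : nat => Num.truncn (c * 2 `^ (log2 m%:R * log2 m%:R : R))).
  apply/funext => -[|m].
    by rewrite /log2 ln0 // !mul0r !powRr0.
  by rewrite powRrM log2K // ltr0n.
apply: (@sublinear_exponent_forces_rate _ _ _ 2^-1) => //.
- by rewrite invf_lt1 ?ltr1n.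
- have [N logN] := @log2_le_powR R 2^-1 2^-1 ltac:(by rewrite invr_gt0) ltac:(by rewrite invr_gt0).
  exists N.+1 => m Nm; have m1 : 1 <= m%:R :> R by rewrite ler1n (leq_ltn_trans _ Nm).
  have := logN m (ltnW Nm); rewrite powR12_sqrt // => lm.
  have := ler_pM (log2_ge0 m1) (log2_ge0 m1) lm lm.
  have -> : 2^-1 * Num.sqrt m%:R * (2^-1 * Num.sqrt m%:R) = Num.sqrt m%:R ^+ 2 / 4 :> R by field.
  by rewrite sqr_sqrtr //; lra.
move=> g g0 gr; pose g' := g / (2 * r).
have g'0 : 0 < g' by rewrite divr_gt0 ?mulr_gt0.
have g'r : r / 2 <= r - g'.
  suff : g' <= r / 2 by lra.
  by rewrite ler_pdivrMr ?mulr_gt0 //; move: gr; rewrite expr2; lra.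
exists g' => // k.
exists (Num.truncn ((2 * log2 k.+1%:R / r) ^+ 2)).+1 => n m Nn mL.
have k0 : 0 <= log2 k.+1%:R :> R by rewrite log2_ge0 // ler1n.
have sqn : 2 * log2 k.+1%:R / r <= Num.sqrt n%:R.
  have q0 : 0 <= 2 * log2 k.+1%:R / r by rewrite divr_ge0 ?(ltW r0) // mulr_ge0.
  rewrite -[leLHS](ger0_norm q0) -sqrtr_sqr ler_wsqrtr //.
  by apply/ltW/(lt_le_trans (truncnS_gt _)); rewrite ler_nat.
have x0 : 0 <= (r - g') * Num.sqrt n%:R by rewrite mulr_ge0 ?sqrtr_ge0 //; lra.
have m0 : 0 < m%:R :> R by rewrite (lt_trans _ mL) // powR_gt0.
have lm : (r - g') * Num.sqrt n%:R <= log2 m%:R by rewrite -powR2_le // ltW.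
split.
  rewrite -(ler_nat R); apply: (@le_trans _ _ k.+1%:R); first by rewrite ler_nat.
  apply: le_trans (ltW mL); rewrite powR2_ge ?ltr0n //.
  apply: (@le_trans _ _ (r / 2 * Num.sqrt n%:R)).
    move: sqn; rewrite ler_pdivrMr //; lra.
  by rewrite ler_wpM2r ?sqrtr_ge0.
apply: le_trans (ler_pM x0 x0 lm lm).
have -> : (r - g') * Num.sqrt n%:R * ((r - g') * Num.sqrt n%:R)
    = Num.sqrt n%:R ^+ 2 * (r - g') ^+ 2 by ring.
rewrite sqr_sqrtr // ler_wpM2l //.
have -> : g = 2 * r * g' by rewrite /g'; field; rewrite gt_eqF.
have := sqr_ge0 g'; rewrite sqrrB; lra.
Qed.

Lemma stretched_exponential_forces_rate c b r : 0 < c -> 1 < b -> 0 < r ->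
  forces_rate (fun r n => r * n%:R `^ b)
    (fun m => Num.truncn (c * 2 `^ (m%:R `^ b^-1))) r (r `^ b^-1).
Proof.
move=> c0 b1 r0; have b0 : 0 < b by rewrite (lt_trans ltr01).
apply: (@sublinear_exponent_forces_rate _ _ _ 2^-1) => //.
- by rewrite invf_lt1 ?ltr1n.
- have bi : 0 < 1 - b^-1 by rewrite subr_gt0 invf_lt1.
  have [N HN] := @powR_unbounded R (1 - b^-1) 2 bi.
  exists N.+1 => m Nm; have m0 : 0 < m%:R :> R by rewrite ltr0n (leq_ltn_trans _ Nm).
  rewrite ler_pdivlMl //; have {2}-> : m%:R = m%:R `^ (1 - b^-1) * m%:R `^ b^-1 :> R.
    rewrite -powRD; last by apply/implyP => _; rewrite gt_eqF.
    by rewrite subrK powRr1 // ltW.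
  by rewrite ler_wpM2r ?powR_ge0 // HN // ltnW.
move=> g g0 gr; pose t := (r `^ b^-1 - g) `^ b.
have rg0 : 0 < r `^ b^-1 - g by rewrite subr_gt0.
have t0 : 0 < t by rewrite powR_gt0.
have tr : t < r.
  have -> : r = (r `^ b^-1) `^ b by rewrite -powRrM mulVf ?gt_eqF // powRr1 // ltW.
  apply: gt0_ltr_powR; rewrite ?nnegrE ?powR_ge0 ?(ltW rg0) //.
  by rewrite ltrBlDr ltrDl.
exists (r - t); first by rewrite subr_gt0.
move=> k; have [N HN] := @powR_unbounded R b (k%:R / t) b0.
exists N => n m /HN {}HN; rewrite subKr => mL; split.
  rewrite -(ler_nat R); apply: le_trans (ltW mL).
  by rewrite mulrC -ler_pdivrMr.
have -> : n%:R * (r `^ b^-1 - g) = (t * n%:R `^ b) `^ b^-1.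
  rewrite /t -powRM ?(ltW rg0) // -powRrM mulfV ?gt_eqF // powRr1 ?mulr_ge0 ?(ltW rg0) //.
  exact: mulrC.
apply: ge0_ler_powR; rewrite ?nnegrE ?invr_ge0 ?(ltW b0) ?(ltW mL) //.
by rewrite mulr_ge0 ?powR_ge0 // ltW.
Qed.

Lemma nearly_exponential_forces_rate c r : 0 < c -> 0 < r ->
  forces_rate (fun r n => r * n%:R * log2 n%:R)
    (fun m => Num.truncn (c * 2 `^ (m%:R / log2 m%:R))) r r.
Proof.
move=> c0 r0.
apply: (@sublinear_exponent_forces_rate _ _ _ 2^-1) => //.
- by rewrite invf_lt1 ?ltr1n.
- exists 4 => m m4; have m4' : 4 <= m%:R :> R by rewrite ler_nat.
  have l2 : 2 <= log2 m%:R :> R.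
    by rewrite -powR2_le ?(lt_le_trans _ m4') // powR_mulrn // -natrX.
  rewrite ler_pdivrMr ?(lt_le_trans _ l2) //.
  have := ler_wpM2l (ler0n R m) l2; lra.
move=> g g0 gr; have g20 : 0 < g / 2 by rewrite divr_gt0.
exists (g / 2) => // k.
pose t := r - g; pose a := r - g / 2.
have t0 : 0 < t by rewrite subr_gt0.
have ta : t < a by rewrite /t /a; lra.
have a0 : 0 < a := lt_trans t0 ta.
have ex0 : 0 < 1 - t / a by rewrite subr_gt0 ltr_pdivrMr // mul1r.
have [M1 logm] := @log2_le_powR R (1 - t / a) t^-1 ex0 ltac:(by rewrite invr_gt0).
pose m0 := (maxn M1 k).+2.
exists (Num.truncn (m0%:R / a)).+2 => n m Nn mL.
have n2 : 2 <= n%:R :> R by rewrite ler_nat (leq_trans _ Nn).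
have n0 : 0 < n%:R :> R by rewrite (lt_le_trans _ n2).
have ln1 : 1 <= log2 n%:R :> R by rewrite -powR2_le // powRr1.
have an : m0%:R <= a * n%:R.
  rewrite mulrC -ler_pdivrMr //.
  by apply/ltW/(lt_le_trans (truncnS_gt _)); rewrite ler_nat ltnW.
have m0m : (m0 <= m)%N.
  rewrite -(ler_nat R); apply/(le_trans an)/(le_trans _ (ltW mL)).
  by rewrite ler_peMr // mulr_ge0 // ltW.
have m1 : 2 <= m%:R :> R by rewrite ler_nat (leq_trans _ m0m).
have m0' : 0 < m%:R :> R by rewrite (lt_le_trans _ m1).
have lm0 : 0 < log2 m%:R :> R.
  by rewrite (lt_le_trans ltr01) // -powR2_le // powRr1.
have /andP[/logm {}logm km] : (M1 <= m)%N && (k <= m)%N by rewrite -geq_max ltnW // ltnW.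
split=> //.
rewrite -/t ler_pdivlMr //.
have [lmn|lmn] := leP (log2 m%:R * (t / a)) (log2 n%:R).
  apply: le_trans (ltW mL); rewrite -/a.
  have -> : n%:R * t * log2 m%:R = a * n%:R * (log2 m%:R * (t / a)).
    by field; rewrite gt_eqF.
  by rewrite ler_wpM2l // mulr_ge0 // ltW.
have nm : n%:R <= m%:R `^ (t / a) by rewrite -[m%:R]log2K // -powRrM powR2_ge // ltW.
apply: (@le_trans _ _ (m%:R `^ (t / a) * t * (t^-1 * m%:R `^ (1 - t / a)))).
  apply: ler_pM => //; [exact/mulr_ge0/ltW | exact: ltW |].
  by rewrite ler_wpM2r // ltW.
rewrite mulrA mulfK ?gt_eqF // -powRD; last by apply/implyP => _; rewrite gt_eqF.
by rewrite addrC subrK powRr1 // ltW.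
Qed.

Lemma full_exponential_forces_rate c b r : 0 < c -> 0 < b -> b <= 1 ->
  (b = 1 -> c < 1) -> 0 < r ->
  forces_rate (fun r n => r * n%:R)
    (fun m => Num.truncn (c * 2 `^ (b * m%:R))) r (r * b).
Proof.
move=> c0 b0 b1 c1 r0.
have rates : forall g, 0 < g -> g < r * b -> exists2 g', 0 < g' &
     forall k : nat, exists N : nat, forall n m : nat, (N <= n)%N ->
       (r - g') * n%:R < m%:R -> (k <= m)%N /\ n%:R * (r * b - g) <= b * m%:R.
  move=> g g0 gr; exists (g / b); first exact: divr_gt0.
  have rg : 0 < r - g / b by rewrite subr_gt0 ltr_pdivrMr.
  move=> k; exists (Num.truncn (k%:R / (r - g / b))).+1 => n m Nn mL; split.
    rewrite -(ler_nat R); apply: le_trans (ltW mL).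
    rewrite mulrC -ler_pdivrMr //.
    by apply/ltW/(lt_le_trans (truncnS_gt _)); rewrite ler_nat.
  have -> : n%:R * (r * b - g) = b * ((r - g / b) * n%:R) by field; rewrite gt_eqF.
  by rewrite ler_wpM2l // ltW.
have [b_eq1|b_neq1] := eqVneq b 1; last first.
  apply: (@sublinear_exponent_forces_rate _ _ _ b) => //.
    by rewrite lt_neqAle b_neq1.
  by exists 0%N.
apply: (@exponential_forces_rate _ _ _ (fun m => b * m%:R) c c) => //; first exact: c1.
by exists 0%N => m _; rewrite b_eq1 mul1r.
Qed.

End ExponentialWeights.

Section Capacity.
Context {R : realType} {X Y : finType}.
Variable W : channel R X Y.
Hypothesis HW : is_channel W.
Variables (L : R -> nat -> R) (S : nat -> nat) (r : R).
Hypothesis ach : achievable_comp_rate W L (fun m => @weight_class m (S m)) r.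

Lemma forced_rate_le_capacity rho : (0 < rho -> forces_rate L S r rho) ->
  (rho%:E <= shannon_capacity W)%E.
Proof.
move=> force; have [rho0|rho0] := ltP 0 rho; last first.
  by apply: le_trans (shannon_capacity_ge0 ach); rewrite lee_fin.
exact/achievable_le_capacity/(achievable_transfer HW rho0 (force rho0) ach).
Qed.

Lemma forced_rate_le_poweR rho b : 0 < b -> 0 < rho -> r = rho `^ b ->
  forces_rate L S r rho -> (r%:E <= poweR (shannon_capacity W) b)%E.
Proof.
move=> b0 rho0 rE force.
have rhoC : (rho%:E <= shannon_capacity W)%E by apply: forced_rate_le_capacity => _; exact: force.
rewrite rE -poweR_EFin; apply: gt0_ler_poweR; rewrite ?in_itv /= ?leey ?andbT //.
- exact: ltW.
- by rewrite lee_fin ltW.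
- exact: shannon_capacity_ge0 ach.
Qed.

End Capacity.

Unset Implicit Arguments.

Theorem theorem2 (R : realType) (X Y : finType) (W : channel R X Y)
  (HW : is_channel W) :
  let C := shannon_capacity W in
  (* (1) S = c, a positive integer; L(R,n) = 2^(Rn) *)
  (forall c : nat, (0 < c)%N ->
     (bfc_capacity W (fun r n => (2 `^ (r * n%:R))%R)
        (fun m => @weight_class m c) <= C)%E) /\
  (* (2) S = c m^beta, beta > 0; L(R,n) = 2^(Rn) *)
  (forall c beta : R, 0 < c -> 0 < beta ->
     (bfc_capacity W (fun r n => (2 `^ (r * n%:R))%R)
        (wclass (fun m => (c * m%:R `^ beta)%R))
      <= C * ((1 + beta)^-1)%:E)%E) /\
  (* (3) S = c m^(log m); L(R,n) = 2^(R sqrt n) *)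
  (forall c : R, 0 < c ->
     (bfc_capacity W (fun r n => (2 `^ (r * Num.sqrt n%:R))%R)
        (wclass (fun m => (c * m%:R `^ log2 m%:R)%R))
      <= poweR C (2^-1))%E) /\
  (* (4) S = c 2^(m^(1/b)), b > 1; L(R,n) = R n^b *)
  (forall c b : R, 0 < c -> 1 < b ->
     (bfc_capacity W (fun r n => (r * n%:R `^ b)%R)
        (wclass (fun m => (c * 2 `^ (m%:R `^ b^-1))%R))
      <= poweR C b)%E) /\
  (* (5) S = c 2^(m / log m); L(R,n) = R n log n *)
  (forall c : R, 0 < c ->
     (bfc_capacity W (fun r n => (r * n%:R * log2 n%:R)%R)
        (wclass (fun m => (c * 2 `^ (m%:R / log2 m%:R))%R))
      <= C)%E) /\
  (* (6) S = c 2^(gamma m), gamma in (0,1]; L(R,n) = R n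
     (for gamma = 1 we need c < 1, see NOTES.md FIDELITY) *)
  (forall c gamma : R, 0 < c -> 0 < gamma -> gamma <= 1 ->
     (gamma = 1 -> c < 1) ->
     (bfc_capacity W (fun r n => (r * n%:R)%R)
        (wclass (fun m => (c * 2 `^ (gamma * m%:R))%R))
      <= C * (gamma^-1)%:E)%E).
Proof.
move=> C; split; [|split; [|split; [|split; [|split]]]].
- move=> c c0; apply/ereal_supP => _ [r ach <-].
  by apply: (forced_rate_le_capacity HW ach) => r0; apply: constant_forces_rate.
- move=> c b c0 b0; apply/ereal_supP => _ [r ach <-].
  have b1 : 0 < 1 + b by rewrite addr_gt0.
  rewrite lee_pdivlMr // -EFinM; apply: (forced_rate_le_capacity HW ach).
  by rewrite pmulr_lgt0 // => r0; apply: polynomial_forces_rate.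
- move=> c c0; apply/ereal_supP => _ [r ach <-].
  have [r0|r0] := ltP 0 r; last by apply: le_trans (poweR_ge0 _ _); rewrite lee_fin.
  apply: (forced_rate_le_poweR HW ach (rho := r ^+ 2)).
  + by rewrite invr_gt0.
  + exact: exprn_gt0.
  + by rewrite powR12_sqrt ?sqr_ge0 // sqrtr_sqr ger0_norm // ltW.
  + exact: quasipolynomial_forces_rate.
- move=> c b c0 b1; have b0 : 0 < b := lt_trans ltr01 b1.
  apply/ereal_supP => _ [r ach <-].
  have [r0|r0] := ltP 0 r; last by apply: le_trans (poweR_ge0 _ _); rewrite lee_fin.
  apply: (forced_rate_le_poweR HW ach (rho := r `^ b^-1)) => //.
  + exact: powR_gt0.
  + by rewrite -powRrM mulVf ?gt_eqF // powRr1 // ltW.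
  + exact: stretched_exponential_forces_rate.
- move=> c c0; apply/ereal_supP => _ [r ach <-].
  by apply: (forced_rate_le_capacity HW ach) => r0; apply: nearly_exponential_forces_rate.
move=> c g c0 g0 g1 c1; apply/ereal_supP => _ [r ach <-].
rewrite lee_pdivlMr // -EFinM; apply: (forced_rate_le_capacity HW ach).
by rewrite pmulr_lgt0 // => r0; apply: full_exponential_forces_rate.
Qed.
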